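(* Let $q\in(0,1)$, and let $$F(x)=\begin{cases}\frac1{1-x},& x\in[0,1);\\ \infty,& x\in\mathbb{R}\setminus[0,1),\end{cases}$$ with the convention $F(\infty)=\infty$ (and $a\cdot\infty=\infty$ for $a>0$). (i) If for some $c\in(0,1]$ one has $$F\big(cF\big(cq\cdots F\big(cq^{N-1}(1+cq^N)\big)\cdots\big)\big)=\infty\quad\text{for some } N\in\mathbb{N},$$ then $$\lim_{n\to\infty}\big(P_n^q(S_n(312))\big)^{\frac1n}=\lim_{n\to\infty}\big(P_n^q(S_n(231))\big)^{\frac1n}>\frac{1-q}{c}.$$ (ii) If for some $c\in(0,1)$ one has $$F\big(cF\big(cq\cdots F\big(cq^{N-1}F\big(c\tfrac{q^N}{1-q}\big)\big)\cdots\big)\big)<\infty\quad\text{for some } N\in\mathbb{N},$$ then $$\lim_{n\to\infty}\big(P_n^q(S_n(312))\big)^{\frac1n}=\lim_{n\to\infty}\big(P_n^q(S_n(231))\big)^{\frac1n}<\frac{1-q}{c}.\qquad( * )$$ In fact, if $c\in(0,1)$ and for some fixed $N$ the condition in (ii) holds with $c$ replaced by $b$, for values $b<c$ arbitrarily close to $c$, then $( * )$ continues to hold with $c$.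
   Context: $S_n$ is the set of permutations $\sigma=\sigma_1\cdots\sigma_n$ of $[n]=\{1,\dots,n\}$, where $\sigma_i=\sigma(i)$. For $\tau\in S_m$ with $2\le m\le n$, $\sigma\in S_n$ contains $\tau$ as a pattern if there are indices $1\le i_1<\cdots<i_m\le n$ such that for all $1\le j,k\le m$, $\sigma_{i_j}<\sigma_{i_k}$ if and only if $\tau_j<\tau_k$; otherwise $\sigma$ avoids $\tau$. $S_n(\tau)$ is the set of $\sigma\in S_n$ avoiding $\tau$ (and $S_n(\tau)=S_n$ if $m>n$). For $q>0$, the Mallows distribution with parameter $q$ is the probability measure on $S_n$ given by $P_n^q(\sigma)=q^{\mathrm{inv}(\sigma)}/Z_n(q)$, where $\mathrm{inv}(\sigma)$ is the number of inversions of $\sigma$, i.e. pairs $i<j$ with $\sigma_i>\sigma_j$, and $Z_n(q)=\sum_{\sigma\in S_n}q^{\mathrm{inv}(\sigma)}$, which for $q\neq 1$ equals $\prod_{k=1}^n\frac{1-q^k}{1-q}$. The nested expressions are read as follows. In (i), put $y_N=1+cq^N$ and $y_{j}=F(cq^{j}y_{j+1})$ for $j=N-1,N-2,\dots,0$; the left-hand side of the condition is $y_0$ (so $F$ is applied $N$ times, with multipliers $c,cq,\dots,cq^{N-1}$ from outermost to innermost). In (ii), the same recursion is used with $y_N=F\big(c\frac{q^N}{1-q}\big)$, and the left-hand side is again $y_0$. Here $\mathbb{N}=\{1,2,\dots\}$. *)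

(* Defs.v *)
From HB Require Import structures.
From mathcomp Require Import all_boot all_order all_algebra all_fingroup.
From mathcomp Require Import all_classical all_reals all_analysis.

Set Implicit Arguments.
Unset Strict Implicit.
Unset Printing Implicit Defensive.

Import Order.TTheory GRing.Theory Num.Theory.

Local Open Scope ring_scope.

(* The indices and values of a permutation in 'S_n run over {0, ..., n-1}
   instead of {1, ..., n}; inversions and pattern containment only compare
   them, so the shift is harmless. *)

Definition inversions n (s : 'S_n) : nat :=
  #|[set p : 'I_n * 'I_n | (p.1 < p.2)%N && (s p.2 < s p.1)%N]|.

Definition contains m n (tau : 'S_m) (s : 'S_n) : bool :=
  [exists i : {ffun 'I_m -> 'I_n},
    [forall j : 'I_m, forall k : 'I_m, (j < k)%N ==> (i j < i k)%N] &&
    [forall j : 'I_m, forall k : 'I_m,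
       (s (i j) < s (i k))%N == (tau j < tau k)%N]].

Definition avoiders m (tau : 'S_m) n : {set 'S_n} :=
  [set s : 'S_n | ~~ contains tau s].

(* One-line notation: the permutation i |-> t_i. *)
Definition one_line n (t : n.-tuple 'I_n) (t_uniq : uniq t) : 'S_n :=
  perm (elimT (tuple_uniqP t) t_uniq).

Definition v1 : 'I_3 := @Ordinal 3 0 isT.
Definition v2 : 'I_3 := @Ordinal 3 1 isT.
Definition v3 : 'I_3 := @Ordinal 3 2 isT.

Definition p312 : 'S_3 := @one_line 3 [tuple v3; v1; v2] isT.
Definition p231 : 'S_3 := @one_line 3 [tuple v2; v3; v1] isT.

Section Mallows.
Variable R : realType.
Implicit Types (q c x : R) (N n : nat).

Definition mallowsZ q n : R := \sum_(s : 'S_n) q ^+ inversions s.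

Definition mallows_mass q n (s : 'S_n) : R := q ^+ inversions s / mallowsZ q n.

Definition mallows q n (A : {set 'S_n}) : R :=
  \sum_(s in A) mallows_mass q s.

Definition avoid_root q m (tau : 'S_m) n : R :=
  mallows q (avoiders tau n) `^ n%:R^-1.

(* The value at -oo is irrelevant: only arguments in ]-oo, +oo] arise. *)
Definition F (x : \bar R) : \bar R :=
  match x with
  | r%:E => if (0 <= r) && (r < 1) then ((1 - r)^-1)%:E else +oo%E
  | _ => +oo%E
  end.

(* F (c F (c q F ( ... F (c q^(N-1) y) ... ))), with N applications of F. *)
Definition nested q c N (y : \bar R) : \bar R :=
  foldr (fun j z => F ((c * q ^+ j)%:E * z)%E) y (iota 0 N).

Definition nested_lower q c N : \bar R := nested q c N (1 + c * q ^+ N)%:E.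

Definition nested_upper q c N : \bar R :=
  nested q c N (F (c * (q ^+ N / (1 - q)))%:E).

End Mallows.

(* Main.v *)
Require Import Defs.
From HB Require Import structures.
From mathcomp Require Import all_boot all_order all_algebra all_fingroup.
From mathcomp Require Import all_classical all_reals all_analysis.
From mathcomp Require Import zify ring lra.
Import Order.TTheory GRing.Theory Num.Theory.
Import numFieldNormedType.Exports.
Set Implicit Arguments.
Unset Strict Implicit.
Unset Printing Implicit Defensive.
Local Open Scope classical_set_scope.
Local Open Scope ring_scope.

(* Let a_n be the sum of q^inv over the 312-avoiding permutations of [n];
   inversion of permutations shows that 231 gives the same numbers. Cutting a
   312-avoiding permutation at its minimum yields
     a_(n+1) = sum_(k <= n) q^k a_k a_(n-k),   i.e.   A(x) = F(x A(qx))
   for the generating function A. The sequence is supermultiplicative, so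
   a_n^(1/n) tends to some L, and (1-q)^n Z_n stays between positive constants,
   so the limit in the theorem is (1-q) L. With weights w_(k+1) = c q^k a_k c^k,
   the sequence a_n c^n satisfies a renewal equation of total weight c A(qc);
   hence L > 1/c if c A(qc) > 1 and L < 1/c if c A(qc) < 1. The nested
   expressions compare with c A(qc): one starts from 1 + x < A(x), respectively
   A(x) < F(x/(1-q)), at x = c q^N and applies A(x) = F(x A(qx)) N times.
   Everything is carried out on the partial sums of A. *)

(** * Permutations avoiding 312 and 231 *)

Lemma ord3_ind (P : 'I_3 -> Prop) : P v1 -> P v2 -> P v3 -> forall i, P i.
Proof.
by move=> P1 P2 P3 [[|[|[|//]]] h]; [move: P1|move: P2|move: P3];
   congr P; apply: val_inj.
Qed.

Lemma contains312P n (s : 'S_n) :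
  reflect (exists x y z : 'I_n, [/\ (x < y)%N, (y < z)%N, (s y < s z)%N & (s z < s x)%N])
    (contains p312 s).
Proof.
have [e1 e2 e3] : [/\ p312 v1 = v3, p312 v2 = v1 & p312 v3 = v2].
  by split; rewrite permE.
apply: (iffP existsP) => [[i /andP[/forallP mono /forallP pat]]|].
  have hm j k := implyP (forallP (mono j) k).
  have hp j k := eqP (forallP (pat j) k).
  exists (i v1), (i v2), (i v3); split; rewrite ?hp ?e1 ?e2 ?e3 //; exact: hm.
move=> [x [y [z [xy yz syz szx]]]].
exists [ffun j : 'I_3 => if j == v1 then x else if j == v2 then y else z].
apply/andP; split; apply/forallP; apply: ord3_ind; apply/forallP; apply: ord3_ind;
  rewrite !ffunE ?e1 ?e2 ?e3 //=; lia.
Qed.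

Lemma contains231P n (s : 'S_n) :
  reflect (exists x y z : 'I_n, [/\ (x < y)%N, (y < z)%N, (s z < s x)%N & (s x < s y)%N])
    (contains p231 s).
Proof.
have [e1 e2 e3] : [/\ p231 v1 = v2, p231 v2 = v3 & p231 v3 = v1].
  by split; rewrite permE.
apply: (iffP existsP) => [[i /andP[/forallP mono /forallP pat]]|].
  have hm j k := implyP (forallP (mono j) k).
  have hp j k := eqP (forallP (pat j) k).
  exists (i v1), (i v2), (i v3); split; rewrite ?hp ?e1 ?e2 ?e3 //; exact: hm.
move=> [x [y [z [xy yz szx sxy]]]].
exists [ffun j : 'I_3 => if j == v1 then x else if j == v2 then y else z].
apply/andP; split; apply/forallP; apply: ord3_ind; apply/forallP; apply: ord3_ind;
  rewrite !ffunE ?e1 ?e2 ?e3 //=; lia.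
Qed.

(** Inverting swaps positions and values: an occurrence of 312 at [x < y < z] in [s] becomes one of
    231 at [s y < s z < s x] in the inverse. *)
Lemma contains231V n (s : 'S_n) : contains p231 s^-1%g = contains p312 s.
Proof.
apply/contains231P/contains312P => -[x [y [z [xy yz h1 h2]]]].
  by exists (s^-1%g z), (s^-1%g x), (s^-1%g y); rewrite !permKV.
by exists (s y), (s z), (s x); rewrite !permK.
Qed.

Lemma inversionsE n (s : 'S_n) :
  inversions s = (\sum_(i < n) \sum_(j < n) ((i < j) && (s j < s i)))%N.
Proof.
rewrite /inversions -sum1_card pair_bigA /= [RHS]big_mkcond [LHS]big_mkcond /=.
by apply: eq_bigr => p _; rewrite inE; case: ifP.
Qed.

Lemma inversionsV n (s : 'S_n) : inversions s^-1%g = inversions s.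
Proof.
rewrite !inversionsE exchange_big /= (reindex_inj (@perm_inj _ s)) /=.
apply: eq_bigr => i _; rewrite (reindex_inj (@perm_inj _ s)) /=.
by apply: eq_bigr => j _; rewrite !permK andbC.
Qed.

(** [lift_perm k ord0 t] has its minimum at position [k], inverted with exactly the [k] entries
    before it. *)
Lemma inversions_lift0 n (k : 'I_n.+1) (t : 'S_n) :
  inversions (lift_perm k ord0 t) = (k + inversions t)%N.
Proof.
rewrite !inversionsE (bigD1_ord k) //= big1 ?add0n; last first.
  by move=> j _; rewrite lift_perm_id ltn0 andbF.
transitivity (\sum_(i < n) ((i < k) + \sum_(j < n) ((i < j) && (t j < t i))))%N.
  apply: eq_bigr => i _; rewrite (bigD1_ord k) //=; congr (_ + _)%N.
    rewrite lift_perm_id lift_perm_lift /= /bump.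
    by case: (ltnP i k) => h; rewrite ?add0n ?h //; rewrite add1n ltnNge leqW.
  apply: eq_bigr => j _; rewrite !lift_perm_lift !lift0 ltnS; congr (_ && _ : nat).
  by rewrite /= /bump; lia.
rewrite big_split /=; congr (_ + _)%N.
rewrite -big_mkcond /= sum1_card.
have kn : (k <= n)%N by rewrite -ltnS.
transitivity #|[set widen_ord kn i | i : 'I_k]|.
  rewrite -[LHS]cardsE; apply: eq_card => i; rewrite !inE.
  apply/idP/imsetP => [h|[j _ ->]]; last exact: (ltn_ord j).
  by exists (Ordinal h) => //; apply: val_inj.
by rewrite card_imset ?card_ord // => i j /(congr1 val) h; apply: val_inj.
Qed.

(** The pair of the minimum's position and the remaining permutation determines the whole;
    injectivity and a count give the bijection. *)
Lemma sum_perm_lift (V : nmodType) n (P : pred 'S_n.+1) (f : 'S_n.+1 -> V) :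
  \sum_(s : 'S_n.+1 | P s) f s =
  \sum_(k < n.+1) \sum_(t : 'S_n | P (lift_perm k ord0 t)) f (lift_perm k ord0 t).
Proof.
rewrite pair_big_dep /=.
pose h (p : 'I_n.+1 * 'S_n) : 'S_n.+1 := lift_perm p.1 ord0 p.2.
have hinj : injective h.
  move=> [k t] [k' t'] /permP e; have kk : k = k'.
    have := e k; rewrite /h /= lift_perm_id; case: (unliftP k' k) => [j ->|->//].
    by rewrite lift_perm_lift => /eqP; rewrite (negbTE (neq_lift _ _)).
  rewrite -{k'}kk in e *; congr pair; apply/permP => i; have := e (lift k i).
  by rewrite /h /= !lift_perm_lift => /lift_inj.
have [g gh hg] : bijective h.
  by apply: inj_card_bij => //; rewrite card_prod !card_Sn card_ord factS.
by rewrite (reindex h) //; exists g => ? _.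
Qed.

(** * Direct sums of permutations *)

Definition block_fun k m (u : 'S_k) (v : 'S_m) (i : 'I_(k + m)) : 'I_(k + m) :=
  match fintype.split i with inl a => lshift m (u a) | inr b => rshift k (v b) end.

Lemma block_fun_inj k m (u : 'S_k) (v : 'S_m) : injective (block_fun u v).
Proof.
have K : cancel (block_fun u v) (block_fun u^-1%g v^-1%g); last exact: can_inj K.
move=> i; rewrite /block_fun.
case: (fintype.split i) (fintype.splitK i) => [a|b] <-.
  by rewrite (fintype.unsplitK (inl _)) permK.
by rewrite (fintype.unsplitK (inr _)) permK.
Qed.

Definition block k m (u : 'S_k) (v : 'S_m) : 'S_(k + m) := perm (@block_fun_inj k m u v).

Lemma block_lshift k m (u : 'S_k) (v : 'S_m) a :
  block u v (lshift m a) = lshift m (u a).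
Proof. by rewrite permE /block_fun (fintype.unsplitK (inl _)). Qed.

Lemma block_rshift k m (u : 'S_k) (v : 'S_m) b :
  block u v (rshift k b) = rshift k (v b).
Proof. by rewrite permE /block_fun (fintype.unsplitK (inr _)). Qed.

Lemma block_inj k m (u u' : 'S_k) (v v' : 'S_m) :
  block u v = block u' v' -> u = u' /\ v = v'.
Proof.
move=> /permP e; split; apply/permP => i.
  by have := e (lshift m i); rewrite !block_lshift => /lshift_inj.
by have := e (rshift k i); rewrite !block_rshift => /rshift_inj.
Qed.

Lemma inversions_block k m (u : 'S_k) (v : 'S_m) :
  inversions (block u v) = (inversions u + inversions v)%N.
Proof.
rewrite !inversionsE big_split_ord /=; congr (_ + _)%N; apply: eq_bigr => i _;
  rewrite big_split_ord /=.
  rewrite [X in (_ + X)%N]big1 ?addn0 => [|j _]; last first.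
    by rewrite block_lshift block_rshift /=; have := ltn_ord (u i); lia.
  by apply: eq_bigr => j _; rewrite !block_lshift.
rewrite [X in (X + _)%N]big1 ?add0n => [|j _]; last first.
  by rewrite block_lshift block_rshift /=; have := ltn_ord j; lia.
by apply: eq_bigr => j _; rewrite !block_rshift /= !ltn_add2l.
Qed.

(** The pattern 312 cannot be cut into a lower initial part and a higher final part, so no
    occurrence straddles the two blocks. *)
Lemma contains312_block k m (u : 'S_k) (v : 'S_m) :
  contains p312 (block u v) = contains p312 u || contains p312 v.
Proof.
apply/contains312P/orP => [[x [y [z [xy yz h1 h2]]]]|].
  have ex (i : 'I_(k + m)) : (exists a, i = lshift m a) \/ (exists b, i = rshift k b).
    by case: (fintype.split i) (fintype.splitK i) => [a|b] <-; [left; exists a|right; exists b].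
  case: (ex x) (ex y) (ex z) => [][a ?] [][b ?] [][c ?]; subst;
    move: xy yz h1 h2; rewrite ?block_lshift ?block_rshift /= => xy yz h1 h2.
  - by left; apply/contains312P; exists a, b, c.
  - by have := ltn_ord (u a); lia.
  - by have := ltn_ord c; lia.
  - by have := ltn_ord (u a); lia.
  - by have := ltn_ord b; lia.
  - by have := ltn_ord b; lia.
  - by have := ltn_ord c; lia.
  - by right; apply/contains312P; exists a, b, c; split; lia.
case=> /contains312P [x [y [z [xy yz h1 h2]]]].
  by exists (lshift m x), (lshift m y), (lshift m z); rewrite !block_lshift.
by exists (rshift k x), (rshift k y), (rshift k z); rewrite !block_rshift /= !ltn_add2l.
Qed.

Lemma block_surj k m (t : 'S_(k + m)) :
  (forall (a : 'I_k) (b : 'I_m), (t (lshift m a) < t (rshift k b))%N) ->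
  exists u v, t = block u v.
Proof.
move=> sep.
have tl a : (t (lshift m a) < k)%N.
  rewrite ltnNge; apply/negP => hk.
  (* Pigeonhole: the [m] values on the right would be distinct and all in [k+1, ..., k+m-1]. *)
  pose s := [seq nat_of_ord (t (rshift k b)) | b <- enum 'I_m].
  have : (size s <= size (iota k.+1 m.-1))%N.
    apply: uniq_leq_size => [|_ /mapP[b _ ->]].
      by rewrite map_inj_uniq ?enum_uniq // => b c /val_inj /perm_inj /rshift_inj.
    by have := sep a b; have := ltn_ord (t (rshift k b)); rewrite mem_iota; lia.
  by rewrite size_map size_iota size_enum_ord; have := ltn_ord (t (lshift m a)); lia.
have uP a : exists b : 'I_k, t (lshift m a) == lshift m b.
  by exists (Ordinal (tl a)); apply/eqP; apply: val_inj.
pose uf a := xchoose (uP a).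
have ufE a : t (lshift m a) = lshift m (uf a) by apply/eqP/(xchooseP (uP a)).
have uf_inj : injective uf.
  by move=> a b e; apply: (@lshift_inj k m); apply: (@perm_inj _ t); rewrite !ufE e.
(* The left positions already exhaust the values below [k], since [uf] is an injection of a finite
   set into itself. *)
have vP b : exists c : 'I_m, t (rshift k b) == rshift k c.
  case: (fintype.split (t (rshift k b))) (fintype.splitK (t (rshift k b))) => [a|c] e;
    last by exists c; rewrite -e.
  have : t (rshift k b) = t (lshift m ((perm uf_inj)^-1%g a)).
    by rewrite ufE -(permE uf_inj) permKV -e.
  by move=> /perm_inj/eqP; rewrite eq_rlshift.
pose vf b := xchoose (vP b).
have vfE b : t (rshift k b) = rshift k (vf b) by apply/eqP/(xchooseP (vP b)).
have vf_inj : injective vf.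
  by move=> a b e; apply: (@rshift_inj k m); apply: (@perm_inj _ t); rewrite !vfE e.
exists (perm uf_inj), (perm vf_inj); apply/permP => i.
case: (fintype.split i) (fintype.splitK i) => [a|b] <- /=.
  by rewrite block_lshift permE ufE.
by rewrite block_rshift permE vfE.
Qed.

(** The inserted minimum can serve as the 1 of 312, which forces the entries before it to lie below
    those after it. *)
Lemma contains312_lift0 k m n (e : (k + m)%N = n) (h : (k < n.+1)%N) (t : 'S_(k + m)) :
  ~~ contains p312 (lift_perm (Ordinal h) ord0 (cast_perm e t)) =
  ~~ contains p312 t && [forall a : 'I_k, forall b : 'I_m, t (lshift m a) < t (rshift k b)]%N.
Proof.
subst n; rewrite cast_perm_id; set o := Ordinal h.
have lt_lift (i j : 'I_(k + m)) : (lift o i < lift o j)%N = (i < j)%N.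
  by rewrite /= /bump; lia.
apply/idP/andP => [/contains312P nc|[/contains312P nc /forallP sep]].
  split; first apply/contains312P => -[x [y [z [xy yz h1 h2]]]].
    apply: nc; exists (lift o x), (lift o y), (lift o z).
    by rewrite !lt_lift !lift_perm_lift !lift0.
  apply/forallP => a; apply/forallP => b; rewrite ltnNge leq_eqVlt.
  apply/negP => /orP[/eqP /val_inj /perm_inj/eqP|lt].
    by rewrite eq_rlshift.
  apply: nc; exists (lift o (lshift m a)), o, (lift o (rshift k b)).
  rewrite lift_perm_id !lift_perm_lift !lift0 !ltnS /=; split=> //.
    by rewrite /bump; have := ltn_ord a; lia.
  by rewrite /bump; lia.
apply/contains312P => -[x [y [z [xy yz]]]].
(* The value 0 can be neither the 3 nor the 2 of an occurrence. If it is not the 1 either, the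
   occurrence lies in [t]; if it is, the other two letters contradict [sep]. *)
case: (unliftP o x) => [x'|] ?; subst x; last by rewrite lift_perm_id ltn0.
case: (unliftP o z) => [z'|] ?; subst z; last by rewrite lift_perm_id ltn0.
case: (unliftP o y) => [y'|] ?; subst y.
  move: xy yz; rewrite !lt_lift !lift_perm_lift !lift0 !ltnS => *.
  by apply: nc; exists x', y', z'.
rewrite !lift_perm_lift !lift0 !ltnS => _.
have [a ->] : exists a, x' = lshift m a.
  have hx : (x' < k)%N by move: xy; rewrite /o /= /bump; lia.
  by exists (Ordinal hx); apply: val_inj.
have [b ->] : exists b, z' = rshift k b.
  have hz : (k <= z')%N by move: yz; rewrite /o /= /bump; lia.
  have hz' : (z' - k < m)%N by have := ltn_ord z'; lia.
  by exists (Ordinal hz'); apply: val_inj; rewrite /= subnKC.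
by have := forallP (sep a) b; lia.
Qed.

(** * Weighted counts of avoiders and the normalizing sum *)

Section Weights.
Variables (R : realType) (q : R).

Definition avoid312 n : R := \sum_(s in avoiders p312 n) q ^+ inversions s.

Lemma avoid312_0 : avoid312 0 = 1.
Proof.
rewrite /avoid312 (big_pred1 1%g) => [|s].
  by rewrite inversionsE big_ord0 expr0.
rewrite inE (permS0 s) /= eqxx; apply/contains312P => -[[//]].
Qed.

(** With the minimum at position [k], the rest is a direct sum of avoiders of sizes [k] and [n - k],
    and the minimum contributes the factor [q ^+ k]. *)
Lemma avoid312_rec n :
  avoid312 n.+1 = \sum_(k < n.+1) q ^+ k * avoid312 k * avoid312 (n - k).
Proof.
rewrite /avoid312 sum_perm_lift; apply: eq_bigr => -[k hk] _ /=.
have [m e] : exists m, (k + m = n)%N by exists (n - k)%N; lia.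
have -> : (n - k = m)%N by lia.
rewrite (reindex (cast_perm e)) /=; last first.
  by subst n; exists id => s _; rewrite cast_perm_id.
pose A := [pred p : 'S_k * 'S_m | ~~ contains p312 p.1 && ~~ contains p312 p.2].
transitivity (\sum_(t in (fun p => block p.1 p.2) @: A)
    q ^+ (k + inversions t)).
  apply: eq_big => [t|t _].
    rewrite inE contains312_lift0; apply/andP/imsetP => [[nc /forallP sep]|[[u v] uv ->]].
      have [u [v tE]] := block_surj (fun a b => forallP (sep a) b).
      by exists (u, v) => //; rewrite inE; move: nc; rewrite tE contains312_block negb_or.
    rewrite contains312_block negb_or; move: uv; rewrite inE => -> /=; split=> //.
    apply/forallP => a; apply/forallP => b; rewrite block_lshift block_rshift /=.
    by have := ltn_ord (u a); lia.
  by subst n; rewrite cast_perm_id inversions_lift0.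
rewrite big_imset /=; last by move=> [u v] [u' v'] _ _ /= /block_inj[-> ->].
rewrite -mulrA big_distrl big_distrr /=.
under [RHS]eq_bigr do rewrite big_distrr big_distrr /=.
rewrite pair_big_dep /=; apply: eq_big => [[u v]|[u v] _]; first by rewrite !inE.
by rewrite /= inversions_block !exprD.
Qed.

Lemma avoid231E n : \sum_(s in avoiders p231 n) q ^+ inversions s = avoid312 n.
Proof.
rewrite (reindex_inj invg_inj) /=; apply: eq_big => [s|s _]; last by rewrite inversionsV.
by rewrite !inE contains231V.
Qed.

Lemma mallowsZ_0 : mallowsZ q 0 = 1.
Proof.
rewrite /mallowsZ (big_pred1 1%g) => [|s]; last by rewrite (permS0 s) /= eqxx.
by rewrite inversionsE big_ord0 expr0.
Qed.

Lemma mallowsZ_rec n : mallowsZ q n.+1 = (\sum_(k < n.+1) q ^+ k) * mallowsZ q n.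
Proof.
rewrite /mallowsZ sum_perm_lift big_distrl /=; apply: eq_bigr => k _.
by rewrite big_distrr; apply: eq_bigr => t _; rewrite inversions_lift0 exprD.
Qed.

Lemma mallows312E n : mallows q (avoiders p312 n) = avoid312 n / mallowsZ q n.
Proof. by rewrite /mallows /mallows_mass -big_distrl. Qed.

Lemma mallows231E n : mallows q (avoiders p231 n) = avoid312 n / mallowsZ q n.
Proof. by rewrite /mallows /mallows_mass -big_distrl /= avoid231E. Qed.

End Weights.

(** * Limits of n-th roots *)

Section Roots.
Variable R : realType.
Implicit Types (u v C L : R) (a : nat -> R).

Lemma root_exprn u n : 0 <= u -> (0 < n)%N -> (u ^+ n) `^ n%:R^-1 = u.
Proof.
move=> u0 n0; rewrite -powR_mulrn // -powRrM divff ?powRr1 //.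
by rewrite pnatr_eq0 -lt0n.
Qed.

Lemma le_root u v n : 0 <= u -> (0 < n)%N -> u ^+ n <= v -> u <= v `^ n%:R^-1.
Proof.
move=> u0 n0 uv; rewrite -{1}(root_exprn u0 n0).
by apply: ge0_ler_powR; rewrite ?invr_ge0 ?nnegrE ?exprn_ge0 // (le_trans _ uv) ?exprn_ge0.
Qed.

Lemma root_le u v n : 0 <= u -> 0 <= v -> (0 < n)%N -> v <= u ^+ n -> v `^ n%:R^-1 <= u.
Proof.
move=> u0 v0 n0 uv; rewrite -(root_exprn u0 n0).
by apply: ge0_ler_powR; rewrite ?invr_ge0 ?nnegrE ?exprn_ge0.
Qed.

Lemma root_cst_cvg C : 0 < C -> C `^ n%:R^-1 @[n --> \oo] --> (1 : R).
Proof.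
move=> C0.
have -> : (fun n : nat => C `^ n%:R^-1) = (fun n => expR (n%:R^-1 * ln C)).
  by apply/funext => n; rewrite /powR gt_eqF.
rewrite [X in _ --> X](_ : 1 = expR (0 * ln C)); last by rewrite mul0r expR0.
apply: continuous_cvg; first exact: continuous_expR.
apply: cvgMl.
have : (fun n : nat => n%:R^-1 : R) @ \oo --> (0 : R).
  by rewrite -cvg_shiftS; exact: cvg_harmonic.
exact.
Qed.

(** Fekete's lemma in multiplicative form: the limit is the supremum of the roots over positive
    indices, finite thanks to [B]. *)
Lemma fekete a (B : R) : (forall n, 1 <= a n) ->
  (forall m n, a m * a n <= a (m + n)%N) -> (forall n, a n <= B ^+ n) ->
  exists L, a n `^ n%:R^-1 @[n --> \oo] --> L.
Proof.
move=> a1 super aB.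
have a0 n : 0 < a n by apply: lt_le_trans (a1 n).
have B0 : 0 <= B by rewrite -[B]expr1 (le_trans (ltW (a0 1%N))).
have pow m k : a m ^+ k <= a (m * k)%N.
  elim: k => [|k IH]; first by rewrite expr0.
  rewrite exprS mulnS (le_trans _ (super _ _)) // ler_wpM2l // ltW //.
pose r n := a n `^ n%:R^-1.
pose E := [set r n.+1 | n in setT].
have Esup : has_sup E.
  split; first by exists (r 1%N), 0%N.
  by exists B => _ [n _ <-]; apply: root_le => //; rewrite ltW.
exists (sup E); apply/cvgrPdist_lt => e e0.
have [_ [m _ <-] hm] := sup_adherent e0 Esup.
(* With [k = n %/ m.+1], one has [a n >= a m.+1 ^+ k >= r m.+1 ^+ n / a m.+1], because
   [n <= m.+1 * k.+1]. The constant divisor disappears in the limit of roots. *)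
have low n : (0 < n)%N -> r m.+1 * (a m.+1)^-1 `^ n%:R^-1 <= r n.
  move=> n0; apply: le_root => //; first by rewrite mulr_ge0 ?powR_ge0.
  rewrite exprMn -[X in _ * X](powR_mulrn n) ?powR_ge0 // -powRrM mulVf ?pnatr_eq0 -?lt0n //.
  rewrite powRr1 ?invr_ge0 ?(ltW (a0 _)) // ler_pdivrMr //.
  have ar : a m.+1 = r m.+1 ^+ m.+1.
    by rewrite -powR_mulrn ?powR_ge0 // -powRrM mulVf ?pnatr_eq0 // powRr1 // ltW.
  have r1 : 1 <= r m.+1 by apply: le_root; rewrite ?expr1n.
  pose k := (n %/ m.+1)%N.
  have kn : (n <= m.+1 * k.+1)%N by rewrite mulnC ltnW // ltn_ceil.
  apply: le_trans (ler_weXn2l r1 kn) _; rewrite exprM -ar exprSr.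
  rewrite ler_wpM2r ?(ltW (a0 _)) // (le_trans (pow _ _)) //.
  have kn' : (m.+1 * k <= n)%N by rewrite mulnC leq_trunc_div.
  rewrite -(subnKC kn') (le_trans _ (super _ _)) // ler_peMr // ltW //.
have : r m.+1 * (a m.+1)^-1 `^ n%:R^-1 @[n --> \oo] --> r m.+1 * 1.
  by apply: cvgMr; apply: root_cst_cvg; rewrite invr_gt0.
rewrite mulr1 => /cvgr_gt /(_ _ hm) near_low.
near=> n.
have n0 : (0 < n)%N by near: n; exact: nbhs_infty_gt.
have up : r n <= sup E.
  by apply: sup_ubound; [case: Esup | exists n.-1; rewrite ?prednK].
have : sup E - e < r n by apply: lt_le_trans (low n n0); near: n.
by rewrite ger0_norm ?subr_ge0 // ltrBlDr ltrBlDl.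
Unshelve. all: by end_near.
Qed.

Lemma root_lim_le a L u : a n `^ n%:R^-1 @[n --> \oo] --> L ->
  0 <= u -> (forall n, 0 <= a n <= u ^+ n) -> L <= u.
Proof.
move=> aL u0 au.
apply: (ler_cvg_to aL (@cvg_cst _ u _ _ _)); near=> n.
have /andP[? ?] := au n; apply: root_le => //.
by near: n; exact: nbhs_infty_gt.
Unshelve. all: by end_near.
Qed.

Lemma root_lim_ge a L u C : a n `^ n%:R^-1 @[n --> \oo] --> L ->
  0 <= u -> 0 < C -> (forall n, C * u ^+ n <= a n) -> u <= L.
Proof.
move=> aL u0 C0 au.
have : C `^ n%:R^-1 * u @[n --> \oo] --> 1 * u.
  by apply: cvgMl; exact: root_cst_cvg.
rewrite mul1r => Cu; apply: (ler_cvg_to Cu aL); near=> n.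
have n0 : (0 < n)%N by near: n; exact: nbhs_infty_gt.
apply: le_root => //; first by rewrite mulr_ge0 ?powR_ge0.
apply: le_trans (au n); rewrite exprMn -[X in X * _](powR_mulrn n) ?powR_ge0 //.
by rewrite -powRrM mulVf ?pnatr_eq0 -?lt0n // powRr1 // ltW.
Unshelve. all: by end_near.
Qed.

(** By continuity in [t] at 1; it lets a strict inequality survive a slight shrinking of the
    parameter. *)
Lemma expr_near1 k (x : R) : 1 < x ->
  exists2 e, 0 < e & forall t, 1 - e < t -> t <= 1 -> 1 < t ^+ k * x.
Proof.
move=> x1; have x0 : 0 < x by apply: lt_trans x1.
have : (fun t : R => t ^+ k * x) t @[t --> (1 : R)] --> 1 ^+ k * x.
  by apply: cvgMl; apply: exprn_continuous.
rewrite expr1n mul1r => /cvgr_gt /(_ _ x1) /nbhs_ballP[e /= e0 he].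
exists e => // t t1 t2; apply: he; rewrite /ball /= ger0_norm ?subr_ge0 //.
by rewrite ltrBlDr -ltrBlDl.
Qed.

(** Convexity of the [k]-th power between 1 and [1 + d]. *)
Lemma bernoulli_interp (t d : R) k : 0 <= t -> t <= 1 -> 0 <= d ->
  (1 + t * d) ^+ k <= 1 - t + t * (1 + d) ^+ k.
Proof.
move=> t0 t1 d0; elim: k => [|k IH]; first by rewrite !expr0 mulr1 subrK.
have X1 : 1 <= (1 + d) ^+ k by rewrite exprn_ege1 // lerDl.
rewrite !exprS; set X := (1 + d) ^+ k in IH X1 *.
have td : 0 <= 1 + t * d by rewrite addr_ge0 ?mulr_ge0.
apply: le_trans (ler_wpM2l td IH) _.
have h : 0 <= t * d * ((1 - t) * (X - 1)) by rewrite !mulr_ge0 ?subr_ge0.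
rewrite -subr_ge0 [X in 0 <= X](_ : _ = t * d * ((1 - t) * (X - 1))) //; ring.
Qed.

Lemma geometric_sum_le (x : R) n : 0 <= x -> x < 1 -> \sum_(k < n) x ^+ k <= (1 - x)^-1.
Proof.
move=> x0 x1; rewrite -[leRHS]mul1r ler_pdivlMr ?subr_gt0 //.
by rewrite mulrC -[1 - x]opprB mulNr -subrX1 opprB lerBlDr lerDl exprn_ge0.
Qed.

End Roots.

(** * The renewal equation *)

(** Truncated Cauchy product: both sides run over the pairs [(k, m)] with [k + m < M]. *)
Lemma sum_cauchy (R : pzRingType) (f g : nat -> R) M :
  \sum_(n < M) \sum_(k < n.+1) f k * g (n - k)%N =
  \sum_(k < M) f k * \sum_(m < M - k) g m.
Proof.
elim: M => [|M IH]; first by rewrite !big_ord0.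
rewrite big_ord_recr /= IH [RHS]big_ord_recr [X in _ + X = _]big_ord_recr /=.
rewrite subnn subSnn big_ord1 addrA -big_split /=; congr (_ + _).
by apply: eq_bigr => k _; rewrite subSn ?(ltnW (ltn_ord k)) // big_ord_recr mulrDr.
Qed.

Section Renewal.
Variables (R : realType) (q : R) (a : nat -> R).
Hypotheses (q0 : 0 < q) (q1 : q < 1) (a0 : a 0 = 1).
Hypothesis arec : forall n, a n.+1 = \sum_(k < n.+1) q ^+ k * a k * a (n - k)%N.

Definition psum M x := \sum_(n < M) a n * x ^+ n.

(** The term [k = 0] of the recursion for [a n.+1] is [a n], and the others are nonnegative. *)
Lemma coef_ge1 n : 1 <= a n.
Proof.
suff h : forall m, (m <= n)%N -> 1 <= a m by exact: h.
elim: n => [|n IH] m; first by rewrite leqn0 => /eqP ->; rewrite a0.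
rewrite leq_eqVlt ltnS => /orP[/eqP -> {m}|/IH//].
rewrite arec big_ord_recl expr0 a0 !mul1r subn0 -[leLHS]addr0 lerD ?IH //.
apply: sumr_ge0 => k _; rewrite !mulr_ge0 ?exprn_ge0 ?(ltW q0) //.
  by rewrite (le_trans ler01) ?IH // ltn_ord.
by rewrite (le_trans ler01) ?IH // leq_subr.
Qed.

Lemma coef_ge0 n : 0 <= a n.
Proof. exact: le_trans ler01 (coef_ge1 n). Qed.

(** Strong induction on [m]: the first [m] terms of the recursion for [a (m + n)] dominate those for
    [a m], each multiplied by [a n]. *)
Lemma coef_supermul m n : a m * a n <= a (m + n)%N.
Proof.
suff h : forall k, (k <= m)%N -> a k * a n <= a (k + n)%N by exact: h.
elim: m => [|m IH] k; first by rewrite leqn0 => /eqP ->; rewrite a0 mul1r.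
rewrite leq_eqVlt ltnS => /orP[/eqP -> {k}|/IH//].
rewrite addSn !arec big_distrl /= -addSn big_split_ord /=.
rewrite -[leLHS]addr0 lerD //; last first.
  by apply: sumr_ge0 => i _; rewrite !mulr_ge0 ?exprn_ge0 ?(ltW q0) ?coef_ge0.
apply: ler_sum => i _; rewrite -mulrA ler_wpM2l ?mulr_ge0 ?exprn_ge0 ?(ltW q0) ?coef_ge0 //.
by rewrite (_ : (m + n - i = m - i + n)%N) ?IH ?leq_subr //; have := ltn_ord i; lia.
Qed.

(** The bound propagates because [1 - q] times the sum of the [q ^+ k] telescopes to
    [1 - q ^+ n.+1]. *)
Lemma coef_le n : a n * (1 - q) ^+ n <= 1.
Proof.
suff h : forall k, (k <= n)%N -> a k * (1 - q) ^+ k <= 1 by exact: h.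
elim: n => [|n IH] k; first by rewrite leqn0 => /eqP ->; rewrite a0 mul1r.
rewrite leq_eqVlt ltnS => /orP[/eqP -> {k}|/IH//].
have p0 : 0 <= 1 - q by rewrite subr_ge0 ltW.
have /le_trans -> // : a n.+1 * (1 - q) ^+ n.+1 <= (1 - q) * \sum_(k < n.+1) q ^+ k.
  rewrite arec big_distrl big_distrr /=; apply: ler_sum => k _.
  have kn : (k <= n)%N by rewrite -ltnS.
  rewrite exprS (_ : (1 - q) ^+ n = (1 - q) ^+ k * (1 - q) ^+ (n - k));
    last by rewrite -exprD subnKC.
  rewrite [leLHS](_ : _ = (1 - q) * q ^+ k *
    ((a k * (1 - q) ^+ k) * (a (n - k)%N * (1 - q) ^+ (n - k)))); last by ring.
  rewrite ler_piMr ?mulr_ge0 ?exprn_ge0 ?(ltW q0) //.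
  by rewrite mulr_ile1 ?mulr_ge0 ?exprn_ge0 ?coef_ge0 ?IH ?leq_subr.
by rewrite -[1 - q]opprB mulNr -subrX1 opprB ?lerBlDr ?lerDl ?exprn_ge0 ?(ltW q0).
Qed.

Lemma psum_ge0 M x : 0 <= x -> 0 <= psum M x.
Proof. by move=> x0; apply: sumr_ge0 => n _; rewrite mulr_ge0 ?exprn_ge0 ?coef_ge0. Qed.

Lemma psum_le M N x : 0 <= x -> (M <= N)%N -> psum M x <= psum N x.
Proof.
move=> x0 MN; rewrite -(subnKC MN) /psum big_split_ord /= lerDl.
by apply: sumr_ge0 => n _; rewrite mulr_ge0 ?exprn_ge0 ?coef_ge0.
Qed.

Lemma psum_homo M x y : 0 <= x -> x <= y -> psum M x <= psum M y.
Proof.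
move=> x0 xy; apply: ler_sum => n _; rewrite ler_wpM2l ?coef_ge0 //.
by rewrite lerXn2r ?nnegrE ?(le_trans x0 xy).
Qed.

Lemma coefS_scaled n x : a n.+1 * x ^+ n.+1 =
  x * \sum_(k < n.+1) (a k * (q * x) ^+ k) * (a (n - k)%N * x ^+ (n - k)).
Proof.
rewrite arec big_distrl big_distrr /=; apply: eq_bigr => k _.
have kn : (k <= n)%N by rewrite -ltnS.
by rewrite exprS exprMn (_ : x ^+ n = x ^+ k * x ^+ (n - k)); [ring | rewrite -exprD subnKC].
Qed.

(** Truncation of A(x) = 1 + x A(qx) A(x), equivalent to A(x) = F(x A(qx)). *)
Lemma psumS M x : psum M.+1 x =
  1 + x * \sum_(k < M) (a k * (q * x) ^+ k) * psum (M - k) x.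
Proof.
rewrite /psum big_ord_recl a0 expr0 mul1r; congr (_ + _).
rewrite -(sum_cauchy (fun k => a k * (q * x) ^+ k) (fun k => a k * x ^+ k)).
by rewrite big_distrr; apply: eq_bigr => n _ /=; rewrite coefS_scaled.
Qed.

Lemma psumS_le M x : 0 <= x -> psum M.+1 x <= 1 + x * (psum M (q * x) * psum M x).
Proof.
move=> x0; rewrite psumS lerD2l ler_wpM2l // [psum M (q * x)]/psum big_distrl /=.
have qx0 : 0 <= q * x by rewrite mulr_ge0 // ltW.
apply: ler_sum => k _; rewrite ler_wpM2l ?psum_le ?leq_subr //.
by rewrite mulr_ge0 ?exprn_ge0 ?coef_ge0.
Qed.

Lemma psumS_ge M N x : 0 <= x ->
  1 + x * (psum M (q * x) * psum N x) <= psum (M + N).+1 x.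
Proof.
move=> x0; rewrite psumS lerD2l ler_wpM2l // [psum M (q * x)]/psum big_distrl /=.
have qx0 : 0 <= q * x by rewrite mulr_ge0 // ltW.
rewrite big_split_ord /= -[leLHS]addr0 lerD //; last first.
  by apply: sumr_ge0 => k _; rewrite !mulr_ge0 ?exprn_ge0 ?coef_ge0 ?psum_ge0.
apply: ler_sum => k _; rewrite ler_wpM2l ?psum_le //.
  by rewrite mulr_ge0 ?exprn_ge0 ?coef_ge0.
by have := ltn_ord k; lia.
Qed.

(** * Total renewal weight and exponential growth *)

(** With total weight at most 1, each term is at most the largest of the earlier ones, and the first
    is 1. *)
Lemma coef_scaled_le1 x n : 0 <= x ->
  (forall M, x * psum M (q * x) <= 1) -> a n * x ^+ n <= 1.
Proof.
move=> x0 hx; suff h : forall k, (k <= n)%N -> a k * x ^+ k <= 1 by exact: h.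
elim: n => [|n IH] k; first by rewrite leqn0 => /eqP ->; rewrite a0 mul1r.
rewrite leq_eqVlt ltnS => /orP[/eqP -> {k}|/IH//].
rewrite coefS_scaled (le_trans _ (hx n.+1)) // ler_wpM2l //.
have qx0 : 0 <= q * x by rewrite mulr_ge0 // ltW.
apply: ler_sum => k _; rewrite ler_piMr ?IH ?leq_subr //.
by rewrite mulr_ge0 ?exprn_ge0 ?coef_ge0.
Qed.

(** Once the first [M] weights sum to at least 1, no later term falls below the least of the earlier
    ones; up to index [M] the bound holds since [a k >= 1] and [x <= 1]. *)
Lemma coef_scaled_ge x M n : 0 <= x -> x <= 1 ->
  1 <= x * psum M (q * x) -> x ^+ M <= a n * x ^+ n.
Proof.
move=> x0 x1 hx; suff h : forall k, (k <= n)%N -> x ^+ M <= a k * x ^+ k by exact: h.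
have small k : (k <= M)%N -> x ^+ M <= a k * x ^+ k.
  move=> kM; rewrite (le_trans (ler_wiXn2l x0 x1 kM)) // ler_peMl ?exprn_ge0 //.
  exact: coef_ge1.
elim: n => [|n IH] k; first by rewrite leqn0 => /eqP ->; rewrite small.
rewrite leq_eqVlt ltnS => /orP[/eqP -> {k}|/IH//].
have [nM|Mn] := leqP n.+1 M; first exact: small.
have qx0 : 0 <= q * x by rewrite mulr_ge0 // ltW.
rewrite coefS_scaled (le_trans (ler_peMl _ hx)) ?exprn_ge0 // -mulrA ler_wpM2l //.
rewrite -(subnKC (ltnW Mn)) /psum big_split_ord big_distrl /= -[leLHS]addr0 lerD //.
  apply: ler_sum => k _; rewrite ler_wpM2l ?IH ?leq_subr //.
  by rewrite mulr_ge0 ?exprn_ge0 ?coef_ge0.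
by apply: sumr_ge0 => k _; rewrite !mulr_ge0 ?exprn_ge0 ?coef_ge0.
Qed.

Lemma psum_shrink M (t x : R) : 0 <= t -> t <= 1 -> 0 <= x ->
  t ^+ M * psum M x <= psum M (t * x).
Proof.
move=> t0 t1 x0; rewrite /psum big_distrr /=; apply: ler_sum => n _.
rewrite exprMn mulrCA ler_wpM2l ?coef_ge0 // ler_wpM2r ?exprn_ge0 //.
by rewrite ler_wiXn2l // ltnW.
Qed.

(** Strictness leaves room to replace [c] by [t * c] with [t < 1] and total weight still at least 1,
    so that [L >= (t * c)^-1 > c^-1]. *)
Lemma growth_gt (L c : R) M : a n `^ n%:R^-1 @[n --> \oo] --> L ->
  0 < c -> c <= 1 -> 1 < c * psum M (q * c) -> c^-1 < L.
Proof.
move=> aL c0 c1 hc.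
(* Shrinking costs one factor [t] from the outer [c] and [M] from [psum_shrink]. The alternative
   [2^-1] below keeps [t] positive. *)
have [e e0 he] := expr_near1 M.+1 hc.
pose t := Num.max (1 - e / 2) 2^-1.
have t1 : t < 1 by rewrite /t gt_max; apply/andP; split; lra.
have t2 : 1 - e < t by rewrite /t lt_max; apply/orP; left; lra.
have t0 : 0 < t by rewrite /t lt_max; apply/orP; right; lra.
have x0 : 0 < t * c by rewrite mulr_gt0.
have xc : t * c < c by rewrite gtr_pMl.
have hx : 1 <= t * c * psum M (q * (t * c)).
  rewrite (le_trans (ltW (he t t2 (ltW t1)))) // exprSr.
  rewrite [leLHS](_ : _ = t * c * (t ^+ M * psum M (q * c))); last by ring.
  by rewrite ler_wpM2l ?(ltW x0) // mulrCA psum_shrink ?mulr_ge0 ?ltW.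
have xL : (t * c)^-1 <= L.
  apply: (root_lim_ge (C := (t * c) ^+ M) aL); rewrite ?invr_ge0 ?exprn_gt0 ?(ltW x0) //.
  move=> n; rewrite exprVn ler_pdivrMr ?exprn_gt0 //.
  by apply: coef_scaled_ge => //; lra.
by apply: lt_le_trans xL; rewrite ltf_pV2 ?posrE.
Qed.

(* As w_k decays like q^k, the weighted sum of w_k rho^k is finite for some
   rho > 1; by convexity in rho it stays below 1 for rho close to 1. *)
Lemma growth_lt (L c s : R) : a n `^ n%:R^-1 @[n --> \oo] --> L ->
  0 < c -> s < 1 -> (forall M, c * psum M (q * c) <= s) -> L < c^-1.
Proof.
move=> aL c0 s1 hc.
have beta1 n : a n * c ^+ n <= 1.
  by apply: coef_scaled_le1 => [|M]; [exact: ltW | exact: le_trans (hc M) (ltW s1)].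
(* Puts [q * (1 + d)] halfway between [q] and 1. The weights, at most [c * q ^+ k] by [beta1], then
   stay summable after multiplication by [(1 + d) ^+ k.+1], with total at most [B]. *)
pose d := (1 - q) / (2 * q).
have d0 : 0 < d by rewrite divr_gt0 ?mulr_gt0 // subr_gt0.
have qd : q * (1 + d) = (1 + q) / 2 by rewrite /d; field; rewrite gt_eqF.
pose B := c * (1 + d) * (1 - q * (1 + d))^-1.
move: (q0) (q1) => q0' q1'.
have qd1 : q * (1 + d) < 1 by rewrite qd; lra.
have qd0 : 0 < q * (1 + d) by rewrite qd; lra.
have B0 : 0 < B by rewrite /B divr_gt0 ?subr_gt0 // mulr_gt0 // addr_gt0.
(* Solves [t * (1 - s + B) = 1 - s], so that interpolating between the totals [s] and [B] gives at
   most 1. *)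
pose t := (1 - s) / (1 - s + B).
have sB : 0 < 1 - s + B by lra.
have t0 : 0 < t by rewrite /t divr_gt0 // subr_gt0.
have t1 : t <= 1 by rewrite /t ler_pdivrMr // mul1r; lra.
have s0 : 0 <= s by have := hc 0%N; rewrite /psum big_ord0 mulr0.
pose rho := 1 + t * d.
have rho1 : 1 < rho by rewrite /rho ltrDl mulr_gt0.
have rho0 : 0 < rho by lra.
have hx M : rho * c * psum M (q * (rho * c)) <= 1.
  have le_sum : rho * c * psum M (q * (rho * c)) <=
      (1 - t) * (c * psum M (q * c)) + t * (c * (1 + d) * \sum_(k < M) (q * (1 + d)) ^+ k).
    rewrite /psum !big_distrr /= -big_split /=; apply: ler_sum => k _.
    have -> : rho * c * (a k * (q * (rho * c)) ^+ k) = c * q ^+ k * (a k * c ^+ k) * rho ^+ k.+1.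
      by rewrite !exprMn exprS; ring.
    have cq0 : 0 <= c * q ^+ k * (a k * c ^+ k).
      by rewrite !mulr_ge0 ?exprn_ge0 ?coef_ge0 ?ltW.
    apply: le_trans (ler_wpM2l cq0 (bernoulli_interp k.+1 (ltW t0) t1 (ltW d0))) _.
    rewrite mulrDr lerD //.
      by rewrite exprMn [leLHS](_ : _ = (1 - t) * (c * (a k * (q ^+ k * c ^+ k)))) //; ring.
    have -> : t * (c * (1 + d) * (q * (1 + d)) ^+ k) = c * q ^+ k * 1 * (t * (1 + d) ^+ k.+1).
      by rewrite exprMn exprS; ring.
    have td0 : 0 <= t * (1 + d) ^+ k.+1.
      by rewrite mulr_ge0 ?exprn_ge0 ?ltW // addr_gt0.
    have cqk0 : 0 <= c * q ^+ k by rewrite mulr_ge0 ?exprn_ge0 ?ltW.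
    exact: ler_wpM2r td0 _ _ (ler_wpM2l cqk0 (beta1 k)).
  apply: le_trans le_sum _.
  have h1 : (1 - t) * (c * psum M (q * c)) <= s.
    apply: (@le_trans _ _ ((1 - t) * s)); first by rewrite ler_wpM2l ?subr_ge0.
    by rewrite ler_piMl // gerBl ltW.
  have h2 : t * (c * (1 + d) * \sum_(k < M) (q * (1 + d)) ^+ k) <= t * B.
    rewrite ler_wpM2l ?(ltW t0) // ler_wpM2l ?mulr_ge0 ?addr_ge0 ?(ltW c0) ?(ltW d0) //.
    by apply: geometric_sum_le => //; exact: ltW.
  have h3 : t * B <= 1 - s.
    have tE : t * (1 - s + B) = 1 - s by rewrite /t divfK ?gt_eqF.
    have : 0 <= t * (1 - s) by rewrite mulr_ge0 ?subr_ge0 ?ltW.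
    rewrite mulrDr in tE; lra.
  lra.
have x0 : 0 < rho * c by rewrite mulr_gt0.
have Lx : L <= (rho * c)^-1.
  apply: (root_lim_le aL); rewrite ?invr_ge0 ?(ltW x0) // => n; rewrite coef_ge0 /=.
  rewrite exprVn -[leRHS]mul1r ler_pdivlMr ?exprn_gt0 //.
  by apply: coef_scaled_le1; rewrite ?ltW.
by apply: le_lt_trans Lx _; rewrite ltf_pV2 ?posrE // ltr_pMl.
Qed.

(** * Comparison with the nested expressions *)

(** The inner part of [nested], with multipliers starting at [c * q ^+ j], so that induction can
    proceed from the inside out. *)
Definition nested_from c j n (y : \bar R) : \bar R :=
  foldr (fun j z => F ((c * q ^+ j)%:E * z)%E) y (iota j n).

Lemma F_finE (r : R) : 0 <= r -> r < 1 -> F r%:E = ((1 - r)^-1)%:E.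
Proof. by move=> r0 r1; rewrite /F r0 r1. Qed.

Lemma F_lty (z : \bar R) : (F z < +oo)%E ->
  exists r, [/\ z = r%:E, 0 <= r, r < 1 & F z = ((1 - r)^-1)%:E].
Proof.
by case: z => [r| |] //=; case: ifP => // /andP[r0 r1] _; exists r; rewrite ?r0 ?r1.
Qed.

(** One level of the lower comparison. The supremum [S] of the partial sums at [x] satisfies
    [1 + x * t * S <= S] for [t = psum M (q * x)]; hence [x * t < 1] and
    [S >= (1 - x * t)^-1 > (1 - x * y)^-1]. *)
Lemma psum_unfold_gt (x y B : R) M : 0 < x -> (forall K, psum K x <= B) ->
  0 <= y -> y < psum M (q * x) ->
  x * y < 1 /\ exists K, (1 - x * y)^-1 < psum K x.
Proof.
move=> x0 xB y0 yT; pose t := psum M (q * x).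
pose E := [set psum K x | K in setT].
have Esup : has_sup E.
  by split; [exists (psum 0 x), 0%N|exists B => _ [K _ <-]].
have upE K : psum K x <= sup E by apply: sup_ubound; [case: Esup|exists K].
have t0 : 0 < t by apply: le_lt_trans yT.
have l1 : 1 <= sup E.
  by rewrite (le_trans _ (upE 1%N)) // /psum big_ord1 a0 mul1r.
have xt0 : 0 < x * t by rewrite mulr_gt0.
have : sup E <= (sup E - 1) / (x * t).
  apply: ge_sup; first by case: Esup.
  move=> _ [K _ <-]; rewrite ler_pdivlMr // lerBrDl.
  apply: le_trans (upE (M + K).+1).
  have := psumS_ge M K (ltW x0); rewrite mulrA (mulrC (psum K x)). exact.
rewrite ler_pdivlMr // => hl.
have xt1 : x * t < 1.
  rewrite ltNge; apply/negP => h.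
  have : sup E * 1 <= sup E * (x * t) by rewrite ler_wpM2l // (le_trans ler01).
  lra.
have xyt : x * y < x * t by rewrite ltr_pM2l.
split; first exact: lt_trans xt1.
have lt_sup : (1 - x * y)^-1 < sup E.
  apply: (@lt_le_trans _ _ (1 - x * t)^-1).
    by rewrite ltf_pV2 ?posrE ?subr_gt0 ?(lt_trans xyt) // ltrD2l ltrN2.
  by rewrite -[leLHS]mul1r ler_pdivrMr ?subr_gt0 // mulrBr mulr1; lra.
have gap : 0 < sup E - (1 - x * y)^-1 by rewrite subr_gt0.
have [_ [K _ <-] hK] := sup_adherent gap Esup.
by exists K; lra.
Qed.

Lemma nested_lower_lt c n j : 0 < c -> (0 < j)%N ->
  (forall M, c * psum M (q * c) <= 1) ->
  exists y, [/\ nested_from c j n (1 + c * q ^+ (j + n))%:E = y%:E, 0 <= y &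
                exists M, y < psum M (c * q ^+ j)].
Proof.
move=> c0 j0 hc; elim: n j j0 => [|n IH] j j0.
  have x0 : 0 < c * q ^+ j by rewrite mulr_gt0 ?exprn_gt0.
  rewrite addn0; exists (1 + c * q ^+ j); split; [by []|by rewrite addr_ge0 ?ltW|].
  (* Three terms suffice: the quadratic one makes the comparison with [1 + x] strict. *)
  exists 3; rewrite /psum !big_ord_recl big_ord0 /= a0 expr0 mul1r addr0 addrA.
  have := coef_ge1 1; have := coef_ge1 2; rewrite /bump /= !add1n expr1 => h2 h1.
  have := ler_peMl (ltW x0) h1; have := mulr_gt0 (lt_le_trans ltr01 h2) (exprn_gt0 2 x0).
  lra.
have [y [yE y0 [M yM]]] := IH j.+1 isT.
have x0 : 0 < c * q ^+ j by rewrite mulr_gt0 ?exprn_gt0.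
(* As [j > 0], the point [c * q ^+ j] is at most [q * c], where [hc] bounds the partial sums. *)
have xB K : psum K (c * q ^+ j) <= c^-1.
  apply: (@le_trans _ _ (psum K (q * c))).
    apply: psum_homo; first exact: ltW.
    rewrite mulrC ler_wpM2r ?(ltW c0) // -(prednK j0) exprS.
    by rewrite ler_piMr ?(ltW q0) // exprn_ile1 // ltW.
  by rewrite -[leRHS]mul1r ler_pdivlMr // mulrC.
rewrite exprS mulrCA in yM.
have [xy1 [K hK]] := psum_unfold_gt x0 xB y0 yM.
exists (1 - c * q ^+ j * y)^-1; split; last by exists K.
  rewrite /nested_from /= -/(nested_from c j.+1 n _) addnS -addSn yE -EFinM F_finE //.
  by rewrite mulr_ge0 ?(ltW x0).
by rewrite invr_ge0 subr_ge0 ltW.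
Qed.

(** At the outermost level the argument of [F] is below [c * psum M (q * c)] for some [M], hence
    below 1. *)
Lemma nested_lower_fin c N : 0 < c -> (0 < N)%N ->
  (forall M, c * psum M (q * c) <= 1) -> nested_lower q c N <> +oo%E.
Proof.
case: N => // N c0 _ hc.
have [y [yE y0 [M yM]]] := nested_lower_lt N c0 (isT : (0 < 1)%N) hc.
rewrite /nested_lower /nested /= -/(nested_from c 1 N _) -add1n yE expr0 mulr1 -EFinM.
rewrite expr1 mulrC in yM; rewrite F_finE //; first by rewrite mulr_ge0 ?(ltW c0).
by apply: lt_le_trans (hc M); rewrite ltr_pM2l.
Qed.

(** By [coef_le] the geometric series in [u] dominates termwise. The gap comes from the linear term:
    [u - x = x * q / (1 - q) >= x * q]. *)
Lemma psum_gap_base x u M : 0 < x -> u = x / (1 - q) -> u < 1 -> psum M x + x * q <= (1 - u)^-1.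
Proof.
move=> x0 uE u1.
have q10 : 0 < 1 - q by rewrite subr_gt0.
have u0 : 0 < u by rewrite uE divr_gt0.
apply: le_trans (geometric_sum_le M.+2 (ltW u0) u1).
apply: (@le_trans _ _ (psum M.+2 x + x * q)).
  by rewrite lerD2r; apply: psum_le; rewrite ?(ltW x0) //; lia.
rewrite /psum !big_ord_recl /= a0 !expr0 mul1r /bump /= !add1n -!addrA lerD2l addrA addrAC.
apply: lerD; last first.
  apply: ler_sum => k _; rewrite uE expr_div_n ler_pdivlMr ?exprn_gt0 //.
  rewrite mulrAC ler_piMl ?exprn_ge0 ?(ltW x0) //.
  exact: (coef_le ).
have a1 : a 1 = 1 by rewrite arec big_ord1 expr0 subn0 a0 !mul1r.
rewrite a1 mul1r !expr1 uE ler_pdivlMr //.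
have := mulr_gt0 x0 (mulr_gt0 q0 q0); nra.
Qed.

(** With [u = x * (y - d)], the partial sums at [x] are at most [(1 - u)^-1]. Raising [u] by [x * d]
    raises this by at least [x * d], the slope being at least 1. *)
Lemma psum_gap_step x y d : 0 < x -> 0 <= d -> x * y < 1 ->
  (forall M, psum M (q * x) + d <= y) -> forall M, psum M x + x * d <= (1 - x * y)^-1.
Proof.
move=> x0 d0 xy hy M.
have dy : d <= y by have := hy 0%N; rewrite /psum big_ord0 add0r.
pose u := x * (y - d).
have u0 : 0 <= u by rewrite mulr_ge0 ?subr_ge0 ?(ltW x0).
have xd0 : 0 <= x * d by rewrite mulr_ge0 ?(ltW x0).
have uE : x * y = u + x * d by rewrite /u; ring.
have u1 : 0 < 1 - u by lra.
(* From [psumS_le] and monotonicity, [psum M.+1 x <= 1 + u * psum M.+1 x]. *)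
have hT : psum M x <= (1 - u)^-1.
  apply: (@le_trans _ _ (psum M.+1 x)).
    by apply: psum_le; rewrite ?(ltW x0).
  have := psumS_le M (ltW x0).
  have Tx0 : 0 <= psum M x by apply: psum_ge0; exact: ltW.
  have hxM : x * psum M (q * x) <= u by rewrite /u ler_wpM2l ?(ltW x0) // lerBrDr.
  have TT : psum M x <= psum M.+1 x by apply: psum_le; rewrite ?(ltW x0).
  have := ler_wpM2r Tx0 hxM; have := ler_wpM2l u0 TT.
  move=> h1 h2 h3; rewrite -[leRHS]mul1r ler_pdivlMr //.
  rewrite mulrBr mulr1 lerBlDr (le_trans h3) // lerD2l (mulrC _ u) (le_trans _ h1) //.
  by rewrite mulrA.
apply: le_trans (lerD hT (lexx _)) _; rewrite uE.
set h := x * d in xd0 uE *.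
have v0 : 0 < 1 - (u + h) by lra.
rewrite -[leRHS]mul1r ler_pdivlMr // mulrDl.
have : (1 - u)^-1 * (1 - (u + h)) = 1 - (1 - u)^-1 * h.
  by field; rewrite gt_eqF.
move=> ->.
have i1 : 1 <= (1 - u)^-1 by rewrite -[leLHS]invr1 lef_pV2 ?posrE //; lra.
have : h * (1 - (u + h)) <= (1 - u)^-1 * h.
  rewrite mulrC ler_wpM2r // (le_trans _ i1) //; lra.
lra.
Qed.

(* The gap d must not depend on b: in the last part of the theorem b tends to c,
   and the strict inequality has to survive the limit. *)
Lemma nested_upper_gap b0 n j : 0 < b0 -> exists2 d, 0 < d &
  forall b, b0 <= b -> (nested_from b j n (F (b * (q ^+ (j + n) / (1 - q)))%:E) < +oo)%E ->
  exists2 y, nested_from b j n (F (b * (q ^+ (j + n) / (1 - q)))%:E) = y%:E &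
    forall M, psum M (b * q ^+ j) + d <= y.
Proof.
move=> b00; have p0 k : 0 < q ^+ k by rewrite exprn_gt0.
elim: n j => [|n IH] j.
  (* The gap of [psum_gap_base] at [x = b * q ^+ j], with [b] lowered to [b0] for uniformity. *)
  exists (b0 * q ^+ j * q) => [|b bb]; first by rewrite !mulr_gt0.
  have b_gt0 : 0 < b by apply: lt_le_trans bb.
  rewrite addn0 => /F_lty [r [[rE] _ r1 ->]].
  have rE' : r = b * q ^+ j / (1 - q) by rewrite -mulrA.
  exists (1 - r)^-1 => // M.
  apply: le_trans (psum_gap_base M (mulr_gt0 b_gt0 (p0 j)) rE' r1).
  by rewrite lerD2l !ler_wpM2r // ltW.
have [d d0 hd] := IH j.+1.
exists (b0 * q ^+ j * d) => [|b bb]; first by rewrite !mulr_gt0.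
have b_gt0 : 0 < b by apply: lt_le_trans bb.
have x0 := mulr_gt0 b_gt0 (p0 j).
rewrite /nested_from /= -/(nested_from b j.+1 n _) addnS -addSn => /F_lty[r [rE _ r1 ->]].
have : (nested_from b j.+1 n (F (b * (q ^+ (j.+1 + n) / (1 - q)))%:E) < +oo)%E.
  by rewrite ltey; apply/eqP => Y; move: rE; rewrite Y gt0_muley ?lte_fin.
move=> /(hd b bb) [y yE hy]; move: rE; rewrite yE -EFinM => -[rE].
rewrite -{r}rE in r1 *; exists (1 - b * q ^+ j * y)^-1 => // M.
apply: (@le_trans _ _ (psum M (b * q ^+ j) + b * q ^+ j * d)).
  by rewrite lerD2l ler_wpM2r ?(ltW d0) // ler_wpM2r // ltW.
apply: psum_gap_step => //; first exact: ltW.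
by move=> K; have := hy K; rewrite exprS mulrCA.
Qed.

(* Taking b = c covers part (ii), taking b < c the last part. *)
Lemma nested_upper_approx c N : 0 < c -> (0 < N)%N ->
  (forall e, 0 < e -> exists b, [/\ c - e < b, b <= c & (nested_upper q b N < +oo)%E]) ->
  exists2 s, s < 1 & forall M, c * psum M (q * c) <= s.
Proof.
case: N => // N c0 _ hc.
have c20 : 0 < c / 2 by rewrite divr_gt0.
have [d d0 hd] := nested_upper_gap N 1 c20.
exists (1 - c * d) => [|M]; first by rewrite gtrBl mulr_gt0.
rewrite lerBrDr -mulrDr leNgt; apply/negP => /(expr_near1 M.+1)[e e0 he].
(* The bound [e * c] ensures [b / c > 1 - e], and [c / 2] keeps [b] in the range where the gap [d]
   is valid. *)
have e'0 : 0 < Num.min (e * c) (c / 2) by rewrite lt_min mulr_gt0.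
have [b [cb bc]] := hc _ e'0; rewrite ltrBlDr in cb.
have b2 : c / 2 <= b.
  have : Num.min (e * c) (c / 2) <= c / 2 by rewrite ge_min lexx orbT.
  lra.
have b0 : 0 < b by apply: lt_le_trans b2.
rewrite /nested_upper /nested /= -/(nested_from b 1 N _) -add1n expr0 mulr1.
move=> /F_lty[r [rE _ r1 _]].
have : (nested_from b 1 N (F (b * (q ^+ (1 + N) / (1 - q)))%:E) < +oo)%E.
  by rewrite ltey; apply/eqP => Y; move: rE; rewrite Y gt0_muley ?lte_fin.
move=> /(hd b b2) [y yE hy]; move: rE; rewrite yE -EFinM => -[rE].
have t0 : 0 < b / c by rewrite divr_gt0.
have t1 : b / c <= 1 by rewrite ler_pdivrMr // mul1r.
have te : 1 - e < b / c.
  have : Num.min (e * c) (c / 2) <= e * c by rewrite ge_min lexx.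
  rewrite ltr_pdivlMr // mulrBl mul1r; lra.
have := he _ te t1; apply/negP; rewrite -leNgt (le_trans _ (ltW r1)) // -rE.
(* Passing from [c] to [b] costs at most the factor [(b / c) ^+ M.+1], after which [he] would still
   give a value above 1, against [r < 1]. *)
apply: (@le_trans _ _ (b * (psum M (b * q ^+ 1) + d))); last first.
  by rewrite ler_wpM2l ?hy // ltW.
rewrite exprSr [leLHS](_ : _ = b * ((b / c) ^+ M * psum M (q * c) + (b / c) ^+ M * d));
  last first.
  by field; rewrite gt_eqF.
rewrite ler_wpM2l ?(ltW b0) // lerD //; last first.
  by rewrite ler_piMl ?(ltW d0) // exprn_ile1 // ltW.
have := @psum_shrink M (b / c) (q * c) (ltW t0) t1 (mulr_ge0 (ltW q0) (ltW c0)).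
by rewrite (_ : b / c * (q * c) = b * q ^+ 1) //; field; rewrite gt_eqF.
Qed.

End Renewal.

(** * The normalization *)

Section Normalization.
Variables (R : realType) (q : R).
Hypotheses (q0 : 0 < q) (q1 : q < 1).

Let W n : R := mallowsZ q n * (1 - q) ^+ n.

Lemma mallowsZ_scaledS n : W n.+1 = (1 - q ^+ n.+1) * W n.
Proof.
have -> : 1 - q ^+ n.+1 = (1 - q) * \sum_(k < n.+1) q ^+ k.
  by rewrite -[1 - q ^+ _]opprB subrX1 -mulNr opprB.
by rewrite /W mallowsZ_rec exprS; ring.
Qed.

Lemma mallowsZ_scaled_le1 n : 0 <= W n <= 1.
Proof.
elim: n => [|n /andP[W0 W1]]; first by rewrite /W mallowsZ_0 mulr1 ler01 lexx.
have p0 : 0 <= 1 - q ^+ n.+1 by rewrite subr_ge0 exprn_ile1 // ltW.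
by rewrite mallowsZ_scaledS mulr_ge0 //= mulr_ile1 // gerBl exprn_ge0 // ltW //.
Qed.

(** [W n] is the product of the [1 - q ^+ k] for [1 <= k <= n]. Each factor is at least
    [expR (- (q ^+ k / (1 - q)))], and the exponents are summable. *)
Lemma mallowsZ_scaled_ge : exists2 C : R, 0 < C & forall n, C <= W n.
Proof.
pose S n := \sum_(k < n) q ^+ k.+1.
have SB n : S n <= q / (1 - q).
  have -> : S n = q * \sum_(k < n) q ^+ k.
    by rewrite big_distrr /=; apply: eq_bigr => k _; rewrite exprS.
  by rewrite ler_wpM2l ?(ltW q0) // geometric_sum_le // ltW.
have q10 : 0 < 1 - q by rewrite subr_gt0.
suff h n : expR (- (S n / (1 - q))) <= W n.
  exists (expR (- (q / (1 - q) / (1 - q)))) => [|n]; first exact: expR_gt0.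
  apply: le_trans (h n); rewrite ler_expR lerN2 ler_wpM2r ?invr_ge0 //.
  exact: ltW.
elim: n => [|n IH].
  by rewrite /S big_ord0 mul0r oppr0 expR0 /W mallowsZ_0 mulr1.
rewrite mallowsZ_scaledS /S big_ord_recr /= -/(S n) mulrDl opprD expRD mulrC.
have x0 : 0 < q ^+ n.+1 by rewrite exprn_gt0.
have xq : q ^+ n.+1 <= q by rewrite exprS ler_piMr ?exprn_ile1 // ltW.
set x := q ^+ n.+1 in x0 xq *.
apply: ler_pM; rewrite ?expR_ge0 //.
(* The factor bound reduces to [(1 - x) * (1 + x / (1 - q)) >= 1], true since [0 <= x <= q]. *)
have E := expR_ge1Dx (x / (1 - q)).
rewrite expRN -[leLHS]mul1r ler_pdivrMr ?expR_gt0 //.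
apply: le_trans (ler_wpM2l _ E); last by lra.
have h : 0 <= (q - x) * x / (1 - q) by rewrite !mulr_ge0 ?invr_ge0 ?subr_ge0 // ltW.
rewrite -subr_ge0 (_ : _ - 1 = (q - x) * x / (1 - q)) //.
by field; rewrite gt_eqF.
Qed.

(** The probability equals [(1 - q) ^+ n * avoid312 q n / W n], and the roots of [W n] tend to 1
    because [C <= W n <= 1]. *)
Lemma avoid312_growth : exists L : R,
  [/\ avoid312 q n `^ n%:R^-1 @[n --> \oo] --> L,
      avoid_root q p312 n @[n --> \oo] --> (1 - q) * L &
      avoid_root q p231 n @[n --> \oo] --> (1 - q) * L].
Proof.
have a0 := avoid312_0 q; have arec := avoid312_rec q.
have q10 : 0 < 1 - q by rewrite subr_gt0.
have a_ge0 n : 0 <= avoid312 q n by exact: (coef_ge0 q0 a0 arec n).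
have [L aL] : exists L : R, avoid312 q n `^ n%:R^-1 @[n --> \oo] --> L.
  apply: (@fekete _ _ (1 - q)^-1);
    [exact: (coef_ge1 q0 a0 arec) | exact: (coef_supermul q0 q1 a0 arec)|].
  move=> n; rewrite exprVn -[leRHS]mul1r ler_pdivlMr ?exprn_gt0 //.
  exact: (coef_le q0 q1 a0 arec n).
have [C C0 hC] := mallowsZ_scaled_ge.
have W0 n : 0 < W n by apply: lt_le_trans (hC n).
have Winv : (W n)^-1 `^ n%:R^-1 @[n --> \oo] --> (1 : R).
  have C10 : 0 < C^-1 by rewrite invr_gt0.
  apply: (@squeeze_cvgr _ _ _ _ (cst 1) (fun n => C^-1 `^ n%:R^-1));
    [near=> n | exact: cvg_cst | exact: root_cst_cvg].
  have n0 : (0 < n)%N by near: n; exact: nbhs_infty_gt.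
  have /andP[_ W1] := mallowsZ_scaled_le1 n.
  rewrite le_root ?expr1n ?invf_ge1 //=.
  by apply: ge0_ler_powR; rewrite ?nnegrE ?invr_ge0 ?(ltW (W0 n)) ?(ltW C0) ?lef_pV2 ?posrE.
have aZ : (avoid312 q n / mallowsZ q n) `^ n%:R^-1 @[n --> \oo] --> (1 - q) * L.
  rewrite -[_ * L]mulr1.
  have P : (1 - q) * avoid312 q n `^ n%:R^-1 * (W n)^-1 `^ n%:R^-1 @[n --> \oo] -->
      (1 - q) * L * 1 by apply: cvgM => //; exact: cvgMr.
  apply: cvg_trans P.
  apply: near_eq_cvg; near=> n.
  have n0 : (0 < n)%N by near: n; exact: nbhs_infty_gt.
  rewrite -[X in X * _ * _](root_exprn (ltW q10) n0) -!powRM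
    ?mulr_ge0 ?invr_ge0 ?exprn_ge0 ?(ltW q10) ?(ltW (W0 n)) //.
  congr (_ `^ _); rewrite /W; field.
  have : mallowsZ q n * (1 - q) ^+ n != 0 by rewrite gt_eqF ?W0.
  by rewrite mulf_eq0 negb_or andbC.
exists L; split=> //; rewrite /avoid_root.
  by under eq_fun do rewrite mallows312E.
by under eq_fun do rewrite mallows231E.
Unshelve. all: by end_near.
Qed.

End Normalization.

Theorem theorem3 (R : realType) (q : R) (hq0 : 0 < q) (hq1 : q < 1) :
  [/\ (forall c : R, 0 < c -> c <= 1 ->
         (exists N : nat, (0 < N)%N /\ nested_lower q c N = +oo%E) ->
         exists l : R,
           [/\ avoid_root q p312 n @[n --> \oo] --> l,
               avoid_root q p231 n @[n --> \oo] --> l &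
               (1 - q) / c < l]),
      (forall c : R, 0 < c -> c < 1 ->
         (exists N : nat, (0 < N)%N /\ (nested_upper q c N < +oo)%E) ->
         exists l : R,
           [/\ avoid_root q p312 n @[n --> \oo] --> l,
               avoid_root q p231 n @[n --> \oo] --> l &
               l < (1 - q) / c]) &
      (forall c : R, 0 < c -> c < 1 ->
         (exists N : nat, (0 < N)%N /\
            forall e : R, 0 < e ->
              exists b : R, [/\ 0 < b, c - e < b, b < c &
                                (nested_upper q b N < +oo)%E]) ->
         exists l : R,
           [/\ avoid_root q p312 n @[n --> \oo] --> l,
               avoid_root q p231 n @[n --> \oo] --> l &
               l < (1 - q) / c])].
Proof.
have q10 : 0 < 1 - q by rewrite subr_gt0.
have a0 := avoid312_0 q; have arec := avoid312_rec q.
have [L [aL L312 L231]] := avoid312_growth hq0 hq1.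
have upper c N : 0 < c -> (0 < N)%N ->
    (forall e, 0 < e -> exists b, [/\ c - e < b, b <= c & (nested_upper q b N < +oo)%E]) ->
    (1 - q) * L < (1 - q) / c.
  move=> c0 N0 hc; have [s s1 hs] := nested_upper_approx hq0 hq1 a0 arec c0 N0 hc.
  by rewrite ltr_pM2l //; apply: growth_lt aL c0 s1 hs.
split=> c c0 c1 [N [N0 hN]]; exists ((1 - q) * L);
  (split; [exact: L312 | exact: L231 |]).
- rewrite ltr_pM2l //.
  (* Otherwise all [c * psum M (q * c)] are at most 1, and the nested expression would be finite. *)
  have [M hM] : exists M, 1 < c * psum (avoid312 q) M (q * c).
    apply: contrapT => /forallNP hle.
    apply: (nested_lower_fin hq0 hq1 a0 arec c0 N0 _ hN) => M.
    by rewrite leNgt; apply/negP.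
  exact: growth_gt hq0 a0 arec _ _ _ aL c0 c1 hM.
- by apply: upper c0 N0 _ => e e0; exists c; rewrite gtrBl.
- by apply: upper c0 N0 _ => e /hN[b [_ cb bc fin]]; exists b; rewrite ltW.
Qed.
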